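(* Let $\Theta=\begin{pmatrix}\mathbb A&K&1\\ \mathcal H_+\subset\mathcal H\subset\mathcal H_-&&\mathbb C\end{pmatrix}$ be an L-system. Then the c-entropy $\mathcal S$ and the coefficient of dissipation $\mathcal D$ of $\Theta$ are related by $$\mathcal D=1-e^{-2\mathcal S}.$$
   Context: Inner products are linear in the first argument. Rigged space. For a closed densely defined symmetric operator $\dot A$ in a Hilbert space $\mathcal H$, $\mathcal H_+=\mathrm{Dom}(\dot A^* )$ with $(f,g)_+=(f,g)+(\dot A^*f,\dot A^*g)$, and $\mathcal H_-$ is the corresponding negative space (dual of $\mathcal H_+$ with respect to the pairing extending the inner product of $\mathcal H$), so $\mathcal H_+\subset\mathcal H\subset\mathcal H_-$. $[\mathcal H_1,\mathcal H_2]$ denotes bounded linear operators. For $\mathbb A\in[\mathcal H_+,\mathcal H_-]$ the adjoint $\mathbb A^*\in[\mathcal H_+,\mathcal H_-]$ is taken with respect to the pairing; $\mathrm{Re}\,\mathbb A=\frac12(\mathbb A+\mathbb A^* )$, $\mathrm{Im}\,\mathbb A=\frac1{2i}(\mathbb A-\mathbb A^* )$. Extensions. A quasi-self-adjoint extension of $\dot A$ is a non-symmetric operator $T$ in $\mathcal H$ with $\dot A\subset T\subset\dot A^*$. A self-adjoint bi-extension of $\dot A$ is $\mathbb B\in[\mathcal H_+,\mathcal H_-]$ with $\dot A\subset\mathbb B=\mathbb B^*$; its quasi-kernel is the restriction of $\mathbb B$ to $\{f\in\mathcal H_+:\mathbb Bf\in\mathcal H\}$; it is t-self-adjoint if its quasi-kernel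 is self-adjoint in $\mathcal H$. If $T$ is a quasi-self-adjoint extension of $\dot A$ with $\rho(T)\neq\emptyset$, a $( * )$-extension of $T$ is $\mathbb A\in[\mathcal H_+,\mathcal H_-]$ with $\mathbb A\supset T\supset\dot A$, $\mathbb A^*\supset T^*\supset\dot A$ and $\mathrm{Re}\,\mathbb A$ a t-self-adjoint bi-extension of $\dot A$. L-system. An array $\Theta$ as in the claim is an L-system if (1) $T$ is a dissipative ($\mathrm{Im}(Tf,f)\ge0$, $f\in\mathrm{Dom}(T)$) quasi-self-adjoint extension, with $\rho(T)\ne\emptyset$, of a symmetric operator $\dot A$ with deficiency indices $(1,1)$; (2) $\mathbb A$ is a $( * )$-extension of $T$; (3) $\mathrm{Im}\,\mathbb A=KK^*$ with $K\in[\mathbb C,\mathcal H_-]$, $K^*\in[\mathcal H_+,\mathbb C]$. $T$ is called the main operator. The transfer function is $W_\Theta(z)=I-2iK^*(\mathbb A-zI)^{-1}K$, $z\in\rho(T)$. c-entropy: $\mathcal S=-\ln(|W_\Theta(-i)|)$, with $\mathcal S=\infty$ (and $e^{-2\mathcal S}=0$) if $W_\Theta(-i)=0$. Coefficient of dissipation: let $g'_\pm\in\operatorname{Ker}(\dot A^*\mp iI)$, $\|g'_\pm\|=1$ (norm of $\mathcal H$), be a fixed deficiency basis chosen so that the von Neumann parameter $\kappa$ of $T$, i.e. the number $|\kappa|<1$ with $g'_+-\kappa g'_-\in\mathrm{Dom}(T)$, satisfies $0\le\kappa\le1$. With $\tilde y=g'_+-\kappa g'_-$, the coefficient of dissipation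 is $\mathcal D=\mathrm{Im}(T\tilde y,\tilde y)$. *)

(* Defs.v *)
From HB Require Import structures.
From mathcomp Require Import all_boot all_order all_algebra complex ring.
From mathcomp Require Import all_classical all_reals all_analysis.

Set Implicit Arguments.
Unset Strict Implicit.
Unset Printing Implicit Defensive.

Import Order.TTheory GRing.Theory Num.Theory Num.Def.
Import numFieldNormedType.Exports.

Local Open Scope classical_set_scope.
Local Open Scope ring_scope.

(* The forms {dot H for conjC} are linear in the first argument and
   conjugate-linear in the second one. Norms of complex normed modules take
   their (real) values in R[i]. *)
HB.mixin Record NormedModule_isPreHilbert (R : realType) (H : Type)
    & NormedModule R[i] H := {
  ip : {dot H for @conjC R[i]} ;
  ip_normE : forall x : H, `|x| ^+ 2 = ip x x
}.

#[short(type="preHilbertType")]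
HB.structure Definition PreHilbert (R : realType) :=
  {H of NormedModule R[i] H & NormedModule_isPreHilbert R H}.

#[short(type="hilbertType")]
HB.structure Definition Hilbert (R : realType) :=
  {H of PreHilbert R H & Complete H}.

Section DotNorm.
Variables (C : numClosedFieldType) (U : lmodType C) (form : {dot U for @conjC C}).

Lemma dotZZ (a b : C) (u v : U) :
  form (a *: u) (b *: v) = a * (b^* * form u v).
Proof.
rewrite (@linearZl_LR _ _ _ _ _ _ form (b *: v) a u)/=.
by rewrite (@linearZr_LR _ _ _ _ _ _ form u b v).
Qed.

Lemma dot_cauchy_schwarz (u v : U) :
  `|form u v| ^+ 2 <= form u u * form v v.
Proof.
have [->|v0] := eqVneq v 0; first by rewrite !linear0r normr0 expr2 !mulr0.
have vv : 0 < form v v by rewrite dnorm_gt0.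
have vvr : (form v v)^* = form v v by rewrite geC0_conj// ltW.
have := dnorm_ge0 form (form v v *: u - form u v *: v).
rewrite dnormB !dotZZ vvr normCK.
set a := form u v; set b := form v v in vv vvr *; set c := form u u.
have -> : (b * (a^* * a))^* = b * (a^* * a).
  by rewrite [a^* * a]mulrC -normCK rmorphM rmorphXn/= vvr conj_normC.
have -> : b * (b * c) + a * (a^* * b) - (b * (a^* * a) + b * (a^* * a)) =
  b * (c * b - a * a^*) by ring.
by rewrite pmulr_rge0// subr_ge0.
Qed.

Lemma dot_cauchy_schwarz_sqrt (u v : U) :
  `|form u v| <= sqrtC (form u u) * sqrtC (form v v).
Proof.
rewrite -[leLHS]sqrCK// -sqrtCM ?nnegrE ?dnorm_ge0// ler_sqrtC.
- exact: dot_cauchy_schwarz.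
- by rewrite nnegrE exprn_ge0.
- by rewrite nnegrE mulr_ge0// dnorm_ge0.
Qed.

Lemma dot_triangle (u v : U) :
  sqrtC (form (u + v) (u + v)) <= sqrtC (form u u) + sqrtC (form v v).
Proof.
have ge0 w : 0 <= sqrtC (form w w) by rewrite sqrtC_ge0 dnorm_ge0.
rewrite -ler_sqr ?nnegrE ?addr_ge0// sqrrD !sqrtCK dnormD/= [leRHS]addrAC.
rewrite lerD2l; have := (leif_Re_Creal (form u v)).1.
rewrite ReE ler_pdivrMr ?ltr0n// => /le_trans; apply.
by rewrite -[leRHS]mulr_natr ler_wpM2r ?ler0n// dot_cauchy_schwarz_sqrt.
Qed.

Lemma dot_sqrtZ (l : C) (u : U) :
  sqrtC (form (l *: u) (l *: u)) = `|l| * sqrtC (form u u).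
Proof.
by rewrite dnormZ sqrtCM ?nnegrE ?exprn_ge0 ?dnorm_ge0// sqrCK.
Qed.

Lemma dot_sqrt_eq0 (u : U) : sqrtC (form u u) = 0 -> u = 0.
Proof. by move/eqP; rewrite sqrtC_eq0 dnorm_eq0 => /eqP. Qed.

End DotNorm.

Lemma ip_cauchy_schwarz (R : realType) (H : preHilbertType R) (x y : H) :
  `|ip x y| <= `|x| * `|y|.
Proof.
by have := dot_cauchy_schwarz_sqrt (@ip R H) x y; rewrite -!ip_normE !sqrCK.
Qed.

Lemma ipC (R : realType) (H : preHilbertType R) (x y : H) :
  ip x y = (ip y x)^*.
Proof.
by have := @hermC _ false (@conjC R[i]) H ip x y; rewrite expr0 mul1r.
Qed.

Section PartialOperators.
Variables (R : realType) (H : hilbertType R).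

(* The values of [papp] outside [dom] are irrelevant. *)
Record poperator := POperator { dom : set H ; papp :> H -> H }.

Definition linear_op (A : poperator) :=
  dom A 0 /\ forall (a : R[i]) f g, dom A f -> dom A g ->
    dom A (a *: f + g) /\ A (a *: f + g) = a *: A f + A g.

Definition densely_defined (A : poperator) := dense (dom A).

Definition closed_op (A : poperator) :=
  closed [set p : H * H | dom A p.1 /\ p.2 = A p.1].

Definition op_incl (A B : poperator) :=
  dom A `<=` dom B /\ (forall f, dom A f -> B f = A f).

Definition op_eq (A B : poperator) := op_incl A B /\ op_incl B A.

Definition symmetric_op (A : poperator) :=
  forall f g, dom A f -> dom A g -> ip (A f) g = ip f (A g).

Definition adjoint_rel (A : poperator) (g : H) : set H :=
  [set h | forall f, dom A f -> ip (A f) g = ip f h].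

(* When A is densely defined, [adjoint_rel A g] has at most one element. *)
Definition adjoint (A : poperator) : poperator :=
  POperator [set g | adjoint_rel A g !=set0] (fun g => xget 0 (adjoint_rel A g)).

Definition selfadjoint_op (A : poperator) :=
  [/\ linear_op A, densely_defined A & op_eq A (adjoint A)].

Definition dissipative_op (T : poperator) :=
  forall f, dom T f -> 0 <= complex.Im (ip (T f) f).

Definition resolvent_set (T : poperator) : set R[i] :=
  [set z | (forall h, exists! f, dom T f /\ T f - z *: f = h) /\
    exists M : R[i], forall f, dom T f -> `|f| <= M * `|T f - z *: f| ].

Definition has_dim (V : set H) (n : nat) :=
  exists e : 'I_n -> H,
    (forall c : 'I_n -> R[i], \sum_i c i *: e i = 0 -> forall i, c i = 0) /\
    V = [set \sum_i c i *: e i | c in [set: 'I_n -> R[i]]].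

Definition eigenspace_op (A : poperator) (z : R[i]) : set H :=
  [set f | dom A f /\ A f = z *: f].

Definition deficiency_indices (A : poperator) (m n : nat) :=
  has_dim (eigenspace_op (adjoint A) 'i) m /\
  has_dim (eigenspace_op (adjoint A) (- 'i)) n.

Record symmetric_operator := SymmetricOperator {
  so_op :> poperator ;
  so_linear : linear_op so_op ;
  so_dense : densely_defined so_op ;
  so_closed : closed_op so_op ;
  so_sym : symmetric_op so_op
}.

(* T itself is required to be linear, its density follows from A `<=` T. *)
Definition quasi_selfadjoint_extension (A : symmetric_operator) (T : poperator) :=
  [/\ linear_op T, ~ symmetric_op T, op_incl A T & op_incl T (adjoint A)].

Lemma dense_ip_eq0 (A : poperator) (h : H) : densely_defined A ->
  (forall f, dom A f -> ip f h = 0) -> h = 0.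
Proof.
move=> dA Ah; apply/eqP; apply/negP => /negP h0.
have nh : 0 < `|h| by rewrite normr_gt0.
have [x [/=]] := dA (ball h `|h|) (ex_intro _ h (ballxx h nh)) (@ball_open _ _ _ _).
rewrite -ball_normE/= => xh /Ah xh0; move: xh.
rewrite -(@ltr_pXn2r _ 2)// ?nnegrE// !ip_normE dnormB.
have -> : ip h x = 0 by rewrite ipC xh0 conjC0.
by rewrite conjC0 !addr0 subr0 -!ip_normE gtrDl le_gtF ?exprn_ge0.
Qed.

Lemma adjoint_relP (A : poperator) g : dom (adjoint A) g ->
  forall f, dom A f -> ip (A f) g = ip f (adjoint A g).
Proof. by move=> [h gh]; exact: (xgetPex 0 (ex_intro _ h gh)). Qed.

Lemma adjoint_unique (A : poperator) g h : densely_defined A ->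
  adjoint_rel A g h -> adjoint A g = h.
Proof.
move=> dA gh; apply/eqP; rewrite -subr_eq0; apply/eqP.
apply: (dense_ip_eq0 dA) => f Af; rewrite linearB/=.
by rewrite -(adjoint_relP (ex_intro _ h gh)) ?gh ?subrr.
Qed.

Lemma adjoint_linear (A : poperator) : densely_defined A ->
  linear_op (adjoint A).
Proof.
move=> dA; split; first by exists 0 => f _; rewrite !linear0r.
move=> a f g Af Ag.
have afg : adjoint_rel A (a *: f + g) (a *: adjoint A f + adjoint A g).
  move=> h Ah; rewrite !linearD/= (adjoint_relP Ag)//; congr +%R.
  rewrite (@linearZr_LR _ _ _ _ _ _ ip (A h) a f)/= (adjoint_relP Af)//.
  by rewrite (@linearZr_LR _ _ _ _ _ _ ip h a (adjoint A f)).
by split; [exists (a *: adjoint A f + adjoint A g)|exact: adjoint_unique].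
Qed.

End PartialOperators.

Section PositiveSpace.
Variables (R : realType) (H : hilbertType R) (A : symmetric_operator H).

Definition adjoint_dom : {pred H} := fun f => `[< dom (adjoint A) f >].

Lemma adjoint_domP f : reflect (dom (adjoint A) f) (f \in adjoint_dom).
Proof. exact: asboolP. Qed.

Lemma adjoint_dom_submod_closed : submod_closed adjoint_dom.
Proof.
have [A0 AD] := adjoint_linear (so_dense A).
split=> [|a f g /adjoint_domP Af /adjoint_domP Ag]; apply/adjoint_domP => //.
by case: (AD a f g Af Ag).
Qed.

HB.instance Definition _ :=
  GRing.isSubmodClosed.Build R[i] H adjoint_dom adjoint_dom_submod_closed.

(* The space H_+ is Dom(A^* ) with the graph inner product. *)
Record Hplus := HPlus { hplus_val :> H ; hplus_subproof : hplus_val \in adjoint_dom }.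

HB.instance Definition _ := [isSub for hplus_val].
HB.instance Definition _ := [Choice of Hplus by <:].
HB.instance Definition _ := [SubChoice_isSubLmodule of Hplus by <:].

Lemma hplus_dom (f : Hplus) : dom (adjoint A) f.
Proof. exact/adjoint_domP/hplus_subproof. Qed.

Definition ip_plus (f g : Hplus) : R[i] :=
  ip (f : H) (g : H) + ip (adjoint A f) (adjoint A g).

Lemma hplus_valP (a : R[i]) (f g : Hplus) :
  hplus_val (a *: f + g) = a *: hplus_val f + hplus_val g.
Proof. by rewrite -[hplus_val]/(\val) linearP. Qed.

Lemma hplus_adjP (a : R[i]) (f g : Hplus) :
  adjoint A (hplus_val (a *: f + g)) = a *: adjoint A f + adjoint A g.
Proof.
have [_ AD] := adjoint_linear (so_dense A).
by rewrite hplus_valP; case: (AD a f g (hplus_dom f) (hplus_dom g)).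
Qed.

Lemma ipDl (x y z : H) a : ip (a *: x + y) z = a * ip x z + ip y z.
Proof. by rewrite linearDl/= (@linearZl_LR _ _ _ _ _ _ ip z a x). Qed.

Lemma ipDr (x y z : H) a : ip z (a *: x + y) = a^* * ip z x + ip z y.
Proof. by rewrite linearDr/= (@linearZr_LR _ _ _ _ _ _ ip z a x). Qed.

Lemma ip_plus_bilinear : bilinear_for (GRing.Scale.Law.clone _ _ *%R _) (GRing.Scale.Law.clone _ _ (@conjC R[i] \; *%R) _) ip_plus.
Proof.
split=> [g a f1 f2|f a g1 g2] /=.
  by rewrite /ip_plus hplus_adjP hplus_valP !ipDl mulrDr addrACA.
by rewrite /ip_plus hplus_adjP hplus_valP !ipDr mulrDr addrACA.
Qed.

HB.instance Definition _ := bilinear_isBilinear.Build R[i] Hplus Hplus R[i]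
  _ _ ip_plus ip_plus_bilinear.

Lemma ip_plus_hermitian (f g : Hplus) :
  ip_plus f g = (-1) ^+ false * conjC (ip_plus g f).
Proof. by rewrite expr0 mul1r /ip_plus rmorphD/= -!ipC. Qed.

HB.instance Definition _ :=
  isHermitianSesquilinear.Build R[i] Hplus false conjC ip_plus ip_plus_hermitian.

Lemma ip_plus_gt0 (f : Hplus) : f != 0 -> 0 < ip_plus f f.
Proof.
move=> f0; rewrite /ip_plus ltr_pwDl ?dnorm_ge0// dnorm_gt0.
by apply: contra f0 => /eqP f0; apply/eqP/val_inj.
Qed.

HB.instance Definition _ := isDotProduct.Build R[i] Hplus ip_plus ip_plus_gt0.

Definition norm_plus (f : Hplus) : R[i] := sqrtC (ip_plus f f).

HB.instance Definition _ := Lmodule_isNormed.Build R[i] Hplus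
  (dot_triangle ip_plus) (dot_sqrtZ ip_plus) (dot_sqrt_eq0 (form := ip_plus)).

Lemma ip_plus_normE (f : Hplus) : `|f| ^+ 2 = ip_plus f f.
Proof. exact: sqrtCK. Qed.

HB.instance Definition _ := NormedModule_isPreHilbert.Build R Hplus ip_plus_normE.

Lemma le_norm_plus (f : Hplus) : `|f : H| <= `|f|.
Proof.
by rewrite -(@ler_pXn2r _ 2)// ?nnegrE// !ip_normE lerDl dnorm_ge0.
Qed.

End PositiveSpace.

Section BoundedOperators.
Variables (R : realType) (V W : normedModType R[i]).

Definition bounded_linear : {pred V -> W} := fun f =>
  `[< linear f /\ exists M : R[i], forall x, `|f x| <= M * `|x| >].

Lemma bounded_linear_submod_closed : submod_closed bounded_linear.
Proof.
split=> [|a f g /asboolP[fl [M fM]] /asboolP[gl [N gN]]]; apply/asboolP.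
  split=> [b x y|]; first by rewrite [LHS]/0 scaler0 addr0.
  by exists 0 => x; rewrite normr0 mul0r.
split=> [b x y|].
  by rewrite !fctE fl gl !scalerDr addrACA !scalerA mulrC.
exists (`|a| * M + N) => x; rewrite (le_trans (ler_normD _ _))//.
by rewrite mulrDl lerD ?gN// normrZ -mulrA ler_wpM2l.
Qed.

HB.instance Definition _ :=
  GRing.isSubmodClosed.Build R[i] (V -> W) bounded_linear bounded_linear_submod_closed.

(* [V, W] is a submodule of the pointwise module of functions V -> W. *)
Record blinear := BLinear {
  blinear_fun :> V -> W ; blinear_subproof : blinear_fun \in bounded_linear }.

HB.instance Definition _ := [isSub for blinear_fun].
HB.instance Definition _ := [Choice of blinear by <:].
HB.instance Definition _ := [SubChoice_isSubLmodule of blinear by <:].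

Lemma blinearP (B : blinear) a x y : B (a *: x + y) = a *: B x + B y.
Proof. by have /asboolP[+ _] := blinear_subproof B; exact. Qed.

HB.instance Definition _ (B : blinear) :=
  GRing.isLinear.Build R[i] V W *:%R (blinear_fun B) (@blinearP B).

Lemma blinear_bounded (B : blinear) : exists M : R[i], forall x, `|B x| <= M * `|x|.
Proof. by have /asboolP[_] := blinear_subproof B. Qed.

Lemma blinearDE (B1 B2 : blinear) x : (B1 + B2) x = B1 x + B2 x.
Proof. by rewrite -[blinear_fun (_ + _)]/(\val _) raddfD. Qed.

Lemma blinearNE (B : blinear) x : (- B) x = - B x.
Proof. by rewrite -[blinear_fun (- _)]/(\val _) raddfN. Qed.

Lemma blinearZE (a : R[i]) (B : blinear) x : (a *: B) x = a *: B x.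
Proof. by rewrite -[blinear_fun (_ *: _)]/(\val _) linearZ. Qed.

End BoundedOperators.

Section Antidual.
Variables (R : realType) (V : normedModType R[i]).

Definition bounded_antilinear : {pred V -> R[i]^o} := fun phi =>
  `[< (forall (a : R[i]) x y, phi (a *: x + y) = a^* * phi x + phi y) /\
      exists M : R[i], forall x, `|phi x| <= M * `|x| >].

Lemma bounded_antilinear_submod_closed : submod_closed bounded_antilinear.
Proof.
split=> [|a f g /asboolP[fl [M fM]] /asboolP[gl [N gN]]]; apply/asboolP.
  split=> [b x y|]; first by rewrite [LHS]/0 mulr0 addr0.
  by exists 0 => x; rewrite normr0 mul0r.
split=> [b x y|].
  rewrite !fctE fl gl !scalerDr mulrDr addrACA; congr (_ + _ + _).
  exact: mulrCA.
exists (`|a| * M + N) => x; rewrite (le_trans (ler_normD _ _))//.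
by rewrite mulrDl lerD ?gN// normrZ -mulrA ler_wpM2l.
Qed.

HB.instance Definition _ := GRing.isSubmodClosed.Build R[i] (V -> R[i]^o)
  bounded_antilinear bounded_antilinear_submod_closed.

(* The value [phi x] is the pairing (phi, x), linear in [phi] and
   conjugate-linear in [x]. *)
Record antidual := Antidual {
  antidual_fun :> V -> R[i]^o ;
  antidual_subproof : antidual_fun \in bounded_antilinear }.

HB.instance Definition _ := [isSub for antidual_fun].
HB.instance Definition _ := [Choice of antidual by <:].
HB.instance Definition _ := [SubChoice_isSubLmodule of antidual by <:].

Lemma antidualP (phi : antidual) (a : R[i]) x y :
  phi (a *: x + y) = a^* * phi x + phi y.
Proof. by have /asboolP[+ _] := antidual_subproof phi; exact. Qed.

Lemma antidualDE (phi psi : antidual) x : (phi + psi) x = phi x + psi x.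
Proof. by rewrite -[antidual_fun (_ + _)]/(\val _) raddfD. Qed.

Lemma antidualNE (phi : antidual) x : (- phi) x = - phi x.
Proof. by rewrite -[antidual_fun (- _)]/(\val _) raddfN. Qed.


Lemma antidualZE (a : R[i]) (phi : antidual) x : (a *: phi) x = a * phi x.
Proof.
have := GRing.linearZ_LR (\val : antidual -> V -> R[i]^o) a phi.
by move: (a *: phi) => psi /= ->.
Qed.

Lemma antidual_ext (phi psi : antidual) : phi =1 psi -> phi = psi.
Proof. by move=> e; apply/val_inj/funext. Qed.

Definition antidual_norm (phi : antidual) : R[i] :=
  (sup [set complex.Re `|phi x| | x in [set x : V | `|x| <= 1]])%:C%C.

Lemma Re_normK (z : R[i]) : (complex.Re `|z|)%:C%C = `|z|.
Proof. by rewrite RRe_real// ger0_real. Qed.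

Lemma antidual_has_sup (phi : antidual) :
  has_sup [set complex.Re `|phi x| | x in [set x : V | `|x| <= 1]].
Proof.
have /asboolP[_ [M phiM]] := antidual_subproof phi.
split; first by exists (complex.Re `|phi 0|), 0 => //=; rewrite normr0.
exists (complex.Re `|M|) => _ [x /= x1 <-]; rewrite -lecR !Re_normK.
have [x0|x0] := eqVneq x 0; first by have := phiM x; rewrite x0 normr0 mulr0 => /le_trans; apply.
have M0 : 0 <= M.
  by have := le_trans (normr_ge0 _) (phiM x); rewrite pmulr_lge0// normr_gt0.
by rewrite (le_trans (phiM x))// (ger0_norm M0) ler_piMr.
Qed.

Lemma le_antidual_norm (phi : antidual) x : `|phi x| <= antidual_norm phi * `|x|.
Proof.
have phiZ (a : R[i]) y : phi (a *: y) = a^* * phi y.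
  have := antidualP phi a y 0; rewrite !addr0.
  have := antidualP phi 1 0 0; rewrite scale1r addr0 conjC1 mul1r.
  by rewrite -[X in X = _]addr0 => /addrI <-; rewrite addr0.
have [->|x0] := eqVneq x 0.
  by rewrite -(scale0r 0) phiZ conjC0 mul0r !normr0 scale0r normr0 mulr0.
have nx : 0 < `|x| by rewrite normr_gt0.
rewrite -ler_pdivrMr//.
have -> : `|phi x| / `|x| = (complex.Re `|phi (`|x|^-1 *: x)|)%:C%C.
  by rewrite Re_normK phiZ normrM norm_conjC normfV normr_id mulrC.
rewrite lecR.
apply: ub_le_sup; first exact: (antidual_has_sup phi).2.
exists (`|x|^-1 *: x) => /=.
  by rewrite normrZ normfV normr_id mulVf// gt_eqF.
by [].
Qed.

Lemma antidual_norm_le (phi : antidual) (M : R[i]) : 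
  (forall x, `|x| <= 1 -> `|phi x| <= M) -> antidual_norm phi <= M.
Proof.
move=> phiM; have M0 : 0 <= M by rewrite (le_trans _ (phiM 0 _))// normr0.
rewrite -[leRHS]RRe_real ?ger0_real// lecR.
apply: sup_le_ub; first exact: (antidual_has_sup phi).1.
by move=> _ [x /= /phiM + <-]; rewrite -lecR RRe_real ?ger0_real// Re_normK.
Qed.

Lemma antidual_norm_ge0 (phi : antidual) : 0 <= antidual_norm phi.
Proof.
rewrite ler0c; apply: (@le_trans _ _ (complex.Re `|phi 0|)).
  by rewrite -ler0c Re_normK.
apply: ub_le_sup; first exact: (antidual_has_sup phi).2.
by exists 0 => //=; rewrite normr0.
Qed.

Lemma antidual_normD (phi psi : antidual) :
  antidual_norm (phi + psi) <= antidual_norm phi + antidual_norm psi.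
Proof.
apply: antidual_norm_le => x x1; rewrite antidualDE (le_trans (ler_normD _ _))//.
by rewrite lerD// (le_trans (le_antidual_norm _ _))// ler_piMr ?antidual_norm_ge0.
Qed.

Lemma antidual_normZ (a : R[i]) (phi : antidual) :
  antidual_norm (a *: phi) = `|a| * antidual_norm phi.
Proof.
have leZ b psi : antidual_norm (b *: psi) <= `|b| * antidual_norm psi.
  apply: antidual_norm_le => x x1; rewrite antidualZE normrM ler_wpM2l//.
  by rewrite (le_trans (le_antidual_norm _ _))// ler_piMr ?antidual_norm_ge0.
apply/eqP; rewrite eq_le leZ/=.
have [->|a0] := eqVneq a 0; first by rewrite normr0 mul0r antidual_norm_ge0.
rewrite -ler_pdivlMl ?normr_gt0// -normfV.
by rewrite (le_trans _ (leZ _ _))// scalerA mulVf// scale1r.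
Qed.

Lemma antidual_norm_eq0 (phi : antidual) : antidual_norm phi = 0 -> phi = 0.
Proof.
move=> phi0; apply: antidual_ext => x; apply/eqP; rewrite -normr_le0.
by have := le_antidual_norm phi x; rewrite phi0 mul0r.
Qed.

HB.instance Definition _ := Lmodule_isNormed.Build R[i] antidual
  antidual_normD antidual_normZ antidual_norm_eq0.

End Antidual.

Section DualAdjoint.
Variables (R : realType) (V : normedModType R[i]).

Section Adjoint.
Variable B : blinear V (antidual V).

Lemma dual_adjoint_fun_subproof (g : V) :
  ((fun f => (B f g)^*) : V -> R[i]^o) \in @bounded_antilinear R V.
Proof.
apply/asboolP; split=> [a x y|].
  by rewrite blinearP antidualDE antidualZE rmorphD rmorphM.
have [M BM] := blinear_bounded B; exists (M * `|g|) => x.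
rewrite norm_conjC (le_trans (le_antidual_norm _ _))//.
by rewrite [leRHS]mulrAC ler_wpM2r// BM.
Qed.

Definition dual_adjoint_fun (g : V) : antidual V :=
  Antidual (dual_adjoint_fun_subproof g).

Lemma dual_adjoint_subproof :
  dual_adjoint_fun \in @bounded_linear R V (antidual V).
Proof.
apply/asboolP; split=> [a x y|].
  apply: antidual_ext => f; rewrite antidualDE antidualZE/=.
  by rewrite antidualP rmorphD rmorphM/= conjCK.
have [M BM] := blinear_bounded B; exists M => g.
have M0 : 0 <= M * `|g| := le_trans (normr_ge0 _) (BM g).
apply: antidual_norm_le => x x1; rewrite /= norm_conjC.
rewrite (le_trans (le_antidual_norm _ _))//.
apply: (@le_trans _ _ (M * `|x| * `|g|)); first by rewrite ler_wpM2r ?BM.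
by rewrite [leLHS]mulrAC ler_piMr.
Qed.

(* (B f, g) = (f, B^* g), where (f, phi) is the conjugate of (phi, f). *)
Definition dual_adjoint : blinear V (antidual V) := BLinear dual_adjoint_subproof.

Definition dual_re : blinear V (antidual V) := 2^-1 *: (B + dual_adjoint).
Definition dual_im : blinear V (antidual V) := (2 * 'i)^-1 *: (B - dual_adjoint).

End Adjoint.

Lemma dual_adjointE (B : blinear V (antidual V)) (f g : V) :
  dual_adjoint B g f = (B f g)^*.
Proof. by []. Qed.

Section ChannelAdjoint.
Variable K : blinear R[i]^o (antidual V).

Lemma channel_adjoint_subproof :
  ((fun f => (K 1 f)^*) : V -> R[i]^o) \in @bounded_linear R V R[i]^o.
Proof.
apply/asboolP; split=> [a x y|].
  by rewrite antidualP rmorphD rmorphM/= conjCK.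
by exists `|K 1| => x; rewrite norm_conjC le_antidual_norm.
Qed.

Definition channel_adjoint : blinear V R[i]^o := BLinear channel_adjoint_subproof.

(* (K c, f) = (c, K^* f) *)
Lemma channel_adjointE (c : R[i]^o) (f : V) : K c f = c * (channel_adjoint f)^*.
Proof.
rewrite /= conjCK; have := linearZ_LR (blinear_fun K) c 1.
have -> : c *: (1 : R[i]^o) = c by exact: mulr1.
by move=> ->; rewrite antidualZE.
Qed.

End ChannelAdjoint.
End DualAdjoint.

Section RiggedSpace.
Variables (R : realType) (H : hilbertType R) (A : symmetric_operator H).

(* The triple H_+ `<=` H `<=` H_-, with H_- the anti-dual of H_+. *)
Definition Hminus := antidual (Hplus A).

Lemma embed_subproof (h : H) :
  ((fun f => ip h (f : H)) : Hplus A -> R[i]^o) \in @bounded_antilinear R (Hplus A).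
Proof.
apply/asboolP; split=> [a f g|]; first by rewrite hplus_valP ipDr.
exists `|h| => f; rewrite (le_trans (ip_cauchy_schwarz _ _))//.
by rewrite ler_wpM2l// le_norm_plus.
Qed.

Definition embed (h : H) : Hminus := Antidual (embed_subproof h).

(* The operator B from H_+ to H_- extends the operator T in H. *)
Definition bi_extends (B : Hplus A -> Hminus) (T : poperator H) :=
  forall f, dom T f -> exists2 g : Hplus A, (g : H) = f & B g = embed (T f).

Definition quasi_kernel (B : Hplus A -> Hminus) : poperator H :=
  let graph f := [set h | exists2 g : Hplus A, (g : H) = f & B g = embed h] in
  POperator [set f | graph f !=set0] (fun f => xget 0 (graph f)).

Definition selfadjoint_biextension (B : blinear (Hplus A) Hminus) :=
  bi_extends B A /\ B = dual_adjoint B.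

Definition t_selfadjoint_biextension (B : blinear (Hplus A) Hminus) :=
  selfadjoint_biextension B /\ selfadjoint_op (quasi_kernel B).

Definition star_extension (T : poperator H) (B : blinear (Hplus A) Hminus) :=
  [/\ bi_extends B T, op_incl A T, bi_extends (dual_adjoint B) (adjoint T),
      op_incl A (adjoint T) & t_selfadjoint_biextension (dual_re B)].

(* (B - z I)^-1 phi; this is 0 when phi is not in the range of B - z I. *)
Definition bi_resolvent (B : Hplus A -> Hminus) (z : R[i]) (phi : Hminus) :
  Hplus A := xget 0 [set f | B f - z *: embed f = phi].

Lemma embed_inj : injective embed.
Proof.
move=> h k hk; apply/eqP; rewrite -subr_eq0; apply/eqP.
apply: (dense_ip_eq0 (so_dense A)) => f Af; rewrite ipC; apply/eqP.
rewrite conjC_eq0 linearBl/= subr_eq0; apply/eqP.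
have fA : f \in adjoint_dom A.
  by apply/adjoint_domP; exists (A f) => g Ag; exact: so_sym.
by have /(congr1 (fun phi : Hminus => phi (HPlus fA))) := hk.
Qed.

End RiggedSpace.

Record Lsystem (R : realType) (H : hilbertType R) := LSystem {
  ls_sym : symmetric_operator H ;
  ls_main : poperator H ;
  ls_state : blinear (Hplus ls_sym) (Hminus ls_sym) ;
  ls_channel : blinear R[i]^o (Hminus ls_sym) ;
  ls_deficiency : deficiency_indices ls_sym 1 1 ;
  ls_quasi_selfadjoint : quasi_selfadjoint_extension ls_sym ls_main ;
  ls_dissipative : dissipative_op ls_main ;
  ls_resolvent : resolvent_set ls_main !=set0 ;
  ls_star : star_extension ls_main ls_state ;
  ls_im : forall f : Hplus ls_sym,
    dual_im ls_state f = ls_channel (channel_adjoint ls_channel f)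
}.

Section Entropy.
Variables (R : realType) (H : hilbertType R) (Theta : Lsystem H).

(* The operator W_Theta(z) on the one-dimensional space of scalars, identified
   with a scalar. *)
Definition transfer_function (z : R[i]) : R[i] :=
  1 - 2 * 'i * channel_adjoint (ls_channel Theta)
    (bi_resolvent (ls_state Theta) z (ls_channel Theta 1)).

(* [lne 0 = -oo], hence the entropy is +oo when W_Theta(-i) = 0. *)
Definition c_entropy : \bar R :=
  (- lne (complex.Re `|transfer_function (- 'i)|)%:E)%E.

Definition deficiency_basis (gp gm : H) :=
  [/\ eigenspace_op (adjoint (ls_sym Theta)) 'i gp,
      eigenspace_op (adjoint (ls_sym Theta)) (- 'i) gm,
      `|gp| = 1 & `|gm| = 1].

Definition von_neumann_parameter (gp gm : H) (kappa : R[i]) :=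
  `|kappa| < 1 /\ dom (ls_main Theta) (gp - kappa *: gm).

Definition dissipation_coefficient (gp gm : H) (kappa : R[i]) : R :=
  let y := gp - kappa *: gm in complex.Im (ip (ls_main Theta y) y).

End Entropy.

(* Main.v *)
Require Import Defs.
From mathcomp Require Import all_boot all_order all_algebra complex ring.
From mathcomp Require Import all_classical all_reals all_analysis.

(* Let y = g'_+ - kappa g'_-, w = g'_- - kappa g'_+, and let AA be the state
   operator. Since T y = i (g'_+ + kappa g'_-), Im (T y, y) = 1 - kappa^2, so
   it remains to see that |W_Theta(-i)| = kappa. By von Neumann's decomposition
   and dissipativity Dom T = Dom A + C y, hence w lies in Dom T^*. The identity
   Im AA = K K^* gives |K^* y|^2 = |K^* w|^2 = 1 - kappa^2, and
   (AA + i)(w + kappa y) = 2i (K^* w) K 1. As AA + i is injective, this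
   determines (AA + i)^-1 K, and W_Theta(-i) = - kappa (K^* y) / (K^* w). *)

Set Implicit Arguments.
Unset Strict Implicit.
Unset Printing Implicit Defensive.

Import Order.TTheory GRing.Theory Num.Theory.
Import numFieldNormedType.Exports.

Local Open Scope classical_set_scope.
Local Open Scope ring_scope.

(** * Orthogonal projection onto the closure of a subspace *)

Section Projection.
Variable R : realType.

Lemma near_natSinv_ltC (e : R[i]) : 0 < e ->
  \forall n \near \oo, n.+1%:R^-1 < e.
Proof.
move=> e0; have eR : e = (complex.Re e)%:C%C.
  by rewrite RRe_real// ger0_real// ltW.
have re0 : 0 < complex.Re e by rewrite -ltcR -eR.
have := near_infty_natSinv_lt (PosNum re0).
apply: filterS => n /=; rewrite -ltcR -eR fmorphV rmorph_nat; exact.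
Qed.

Variable H : hilbertType R.
Implicit Types (x y z v : H) (u : nat -> H).

Lemma ipZl (a : R[i]) x y : ip (a *: x) y = a * ip x y.
Proof. by rewrite -[a *: x]addr0 ipDl linear0l addr0. Qed.

Lemma ipZr (a : R[i]) x y : ip x (a *: y) = a^* * ip x y.
Proof. by rewrite -[a *: y]addr0 ipDr linear0r addr0. Qed.

Lemma ip_addl x y z : ip (x + y) z = ip x z + ip y z.
Proof. exact: linearDl. Qed.

Lemma ip_subl x y z : ip (x - y) z = ip x z - ip y z.
Proof. exact: linearBl. Qed.

Lemma ip_subE x y :
  ip (x - y) (x - y) = ip x x + ip y y - (ip x y + (ip x y)^*).
Proof. exact: dnormB. Qed.

Lemma cvg_of_sqr_natSinv (c : R[i]) u :
  (forall m n, (m <= n)%N -> `|u m - u n| ^+ 2 <= c * m.+1%:R^-1) ->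
  cvg (u @ \oo).
Proof.
move=> uc; apply: cauchy_cvg; apply: cauchy_exP => e e0.
have c0 : 0 <= c.
  by have := uc 0 0 (leqnn _); rewrite subrr normr0 expr0n/= invr1 mulr1.
(* The denominator is [c + 1] since [c] may be 0. *)
have ce0 : 0 < e ^+ 2 / (c + 1) by rewrite divr_gt0 ?exprn_gt0// ltr_wpDl.
have [N _ /(_ N (leqnn N))/= Ne] := near_natSinv_ltC ce0.
exists (u N); exists N => // n /= Nn; rewrite -ball_normE/=.
rewrite -(@ltr_pXn2r _ 2)// ?nnegrE ?normr_ge0 ?ltW//.
apply: (le_lt_trans (uc _ _ Nn)).
apply: (@le_lt_trans _ _ ((c + 1) * N.+1%:R^-1)).
  by rewrite ler_wpM2r ?invr_ge0// lerDl.
by rewrite mulrC -ltr_pdivlMr// ltr_wpDl.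
Qed.

Lemma parallelogram x y :
  `|x - y| ^+ 2 = 2 * `|x| ^+ 2 + 2 * `|y| ^+ 2 - `|x + y| ^+ 2.
Proof.
rewrite !ip_normE dnormB dnormD.
by move: (ip x x) (ip y y) (ip x y + _) => a b c; ring.
Qed.

(** Here [d] is the squared distance from [x] to [V]; the infimum is taken over real parts because
    [R[i]] is only partially ordered. *)
Lemma minimizing_seq (V : set H) x : V !=set0 ->
  exists (u : nat -> H) (d : R[i]), [/\ forall n, V (u n),
    forall v, V v -> d <= `|x - v| ^+ 2 &
    forall n, `|x - u n| ^+ 2 <= d + n.+1%:R^-1].
Proof.
move=> [v0 Vv0].
pose q v := complex.Re (`|x - v| ^+ 2).
have qE v : (q v)%:C%C = `|x - v| ^+ 2.
  by rewrite RRe_real// ger0_real// exprn_ge0.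
have q0 : has_inf [set q v | v in V].
  split; first by exists (q v0), v0.
  by exists 0 => _ [v _ <-]; rewrite -lecR qE exprn_ge0.
pose d := inf [set q v | v in V].
have /choice[u uP] (n : nat) : exists v, V v /\ q v < d + n.+1%:R^-1.
  have n0 : 0 < n.+1%:R^-1 :> R by [].
  by have [_ [v Vv <-] qv] := inf_adherent n0 q0; exists v.
exists u, d%:C%C; split=> [n|v Vv|n].
- by have [] := uP n.
- by rewrite -qE lecR; apply: (ge_inf q0.2); exists v.
- have [_ /ltW] := uP n; rewrite -lecR qE rmorphD fmorphV rmorph_nat; exact.
Qed.

(** [V] need not be closed, so [p] is the projection onto its closure. The sequence and its rate are
    returned because a Cauchy estimate on preimages will be read off from them when [V] is a
    range. *)
Lemma orthogonal_projection_seq (V : set H) x : V 0 ->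
  (forall (a : R[i]) f g, V f -> V g -> V (a *: f + g)) ->
  exists u p, [/\ forall n, V (u n), u @ \oo --> p,
    forall m n, (m <= n)%N -> `|u m - u n| ^+ 2 <= 4 * m.+1%:R^-1 &
    forall v, V v -> ip (x - p) v = 0].
Proof.
move=> V0 VD; have VZ a f : V f -> V (a *: f).
  by move=> Vf; rewrite -[a *: f]addr0; exact: VD.
have [u [d [Vu dle du]]] := @minimizing_seq V x (ex_intro _ 0 V0).
have uC m n : (m <= n)%N -> `|u m - u n| ^+ 2 <= 4 * m.+1%:R^-1.
  move=> mn.
  (* Parallelogram law for [x - u n] and [x - u m]: their sum is twice the vector from the midpoint
     of [u m] and [u n], a point of [V], to [x]. The bound is thus 4 (d + 1/(m+1)) - 4 d, whence the
     constant 4. *)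
  have -> : u m - u n = (x - u n) - (x - u m) by rewrite opprB [RHS]addrC addrA subrK.
  rewrite parallelogram.
  have -> : x - u n + (x - u m) = (2:R[i]) *: (x - 2^-1 *: (1 *: u m + u n)).
    rewrite scalerBr scalerA divff// !scale1r scaler_nat mulr2n opprD.
    by rewrite [- u m - _]addrC addrACA.
  rewrite normrZ exprMn ger0_norm//.
  have le1 : `|x - u n| ^+ 2 <= d + m.+1%:R^-1.
    rewrite (le_trans (du n))// lerD2l lef_pV2 ?posrE//.
    by rewrite ler_nat ltnS.
  have le2 := du m.
  have le3 := dle _ (VZ 2^-1 _ (VD 1 _ _ (Vu m) (Vu n))).
  apply: (@le_trans _ _ (2 * (d + m.+1%:R^-1) + 2 * (d + m.+1%:R^-1) - 2 ^+ 2 * d)).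
    by apply: lerB; [apply: lerD|]; rewrite ler_pM2l ?exprn_gt0.
  by rewrite le_eqVlt; apply/orP; left; apply/eqP; ring.
have /cvg_ex[p up] := cvg_of_sqr_natSinv uC.
exists u, p; split=> // v Vv.
have [->|v0] := eqVneq v 0; first by rewrite linear0r.
have vv : 0 < ip v v by rewrite dnorm_gt0.
have vvr : (ip v v)^* = ip v v by rewrite geC0_conj// ltW.
(* Compare u n with u n + s *: v, where s *: v is the projection of x - u n
   onto the line spanned by v. *)
have small n : `|ip (x - u n) v| ^+ 2 <= ip v v * n.+1%:R^-1.
  set t := ip (x - u n) v; pose s := t / ip v v.
  have sC : s^* = t^* / ip v v by rewrite /s rmorphM/= fmorphV/= vvr.
  have := dle _ (VD s _ _ Vv (Vu n)).
  have -> : x - (s *: v + u n) = (x - u n) - s *: v.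
    by rewrite opprD addrCA addrC.
  rewrite ip_normE ip_subE ipZl !ipZr -/t sC -ip_normE.
  have -> : (t^* / ip v v * t)^* = t * t^* / ip v v.
    by rewrite mulrC mulrA -normCK rmorphM/= rmorphXn/= conj_normC fmorphV/= vvr.
  rewrite normCK /s.
  have -> : `|x - u n| ^+ 2 + t / ip v v * (t^* / ip v v * ip v v) -
     (t^* / ip v v * t + t * t^* / ip v v) = `|x - u n| ^+ 2 - t * t^* / ip v v.
    by field; rewrite gt_eqF.
  rewrite lerBrDr => dt; have := le_trans dt (du n).
  by rewrite lerD2l ler_pdivrMr// [_ * ip v v]mulrC.
apply/eqP; apply/negPn/negP => c0.
set c := `|ip (x - p) v|.
have {}c0 : 0 < c by rewrite normr_gt0.
(* These thresholds make [|ip (x - u n) v|] and [|ip (u n - p) v|] both smaller than [c / 2],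
   although their sum is at least [c]. *)
have e1 : 0 < (c / 2) ^+ 2 / ip v v by rewrite divr_gt0// exprn_gt0// divr_gt0.
have e2 : 0 < c / 2 / `|v| by rewrite !divr_gt0// normr_gt0.
near \oo => n.
have : c <= `|ip (x - u n) v| + `|ip (u n - p) v|.
  rewrite /c; have -> : x - p = (x - u n) + (u n - p) by rewrite addrA subrK.
  by rewrite linearDl/= ler_normD.
apply/negP; rewrite -real_ltNge ?realD ?normr_real//.
rewrite [ltRHS](splitr c) ltrD//.
  rewrite -(@ltr_pXn2r _ 2)// ?nnegrE ?normr_ge0 ?divr_ge0 ?ltW//.
  rewrite (le_lt_trans (small n))// mulrC -ltr_pdivlMr//.
  by near: n; exact: near_natSinv_ltC.
rewrite (le_lt_trans (ip_cauchy_schwarz _ _))// -ltr_pdivlMr ?normr_gt0//.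
by near: n; move/cvgrPdistC_lt : up; exact.
Unshelve. all: by end_near. Qed.

End Projection.

(** * Von Neumann's decomposition of the domain of the adjoint *)

Section VonNeumann.
Variables (R : realType) (H : hilbertType R).

Lemma linear_opB (A : poperator H) f g : linear_op A -> dom A f -> dom A g ->
  dom A (f - g) /\ A (f - g) = A f - A g.
Proof.
move=> [_ AD] Af Ag; have := AD (-1) g f Ag Af.
by rewrite !scaleN1r ![- _ + _]addrC.
Qed.

Lemma linear_opZ (A : poperator H) c f : linear_op A -> dom A f ->
  dom A (c *: f) /\ A (c *: f) = c *: A f.
Proof.
move=> [A0 AD] Af; have [_] := AD 1 0 0 A0 A0.
rewrite !scale1r addr0 => /esym/eqP; rewrite -subr_eq0 addrK => /eqP Az.
by have := AD c f 0 Af A0; rewrite !addr0 Az addr0.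
Qed.

Variable A : symmetric_operator H.

(** By symmetry the cross terms -i (Af, f) and i (f, Af) cancel. *)
Lemma symmetric_op_shift_sqr f : dom A f ->
  `|A f + 'i *: f| ^+ 2 = `|A f| ^+ 2 + `|f| ^+ 2.
Proof.
move=> Af; rewrite !ip_normE linearDl/= !linearDr/= !ipZl !ipZr.
rewrite -(so_sym Af Af) conjCi !mulNr mulrN mulrA -expr2 sqrCi.
by rewrite mulN1r opprK addrA subrK.
Qed.

(** The orthogonal complement of the range of A + i is the kernel of A^* - i, and this range is
    closed because A is. *)
Lemma symmetric_op_range_decomposition x : exists a q,
  [/\ dom A a, eigenspace_op (adjoint A) 'i q & x = A a + 'i *: a + q].
Proof.
have lA := so_linear A.
pose V := [set A a + 'i *: a | a in dom A].
have V0 : V 0.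
  have [A0 _] := lA; exists 0 => //.
  by have [_] := linear_opZ 0 lA A0; rewrite !scale0r !scaler0 addr0.
have VD c f g : V f -> V g -> V (c *: f + g).
  move=> [a Aa <-] [b Ab <-]; have [Dab Aab] := lA.2 c a b Aa Ab.
  exists (c *: a + b) => //.
  by rewrite Aab !scalerDr addrACA !scalerA mulrC.
have [u [p [Vu up uC xp]]] := orthogonal_projection_seq x V0 VD.
have /choice[a aP] (n : nat) : exists a, dom A a /\ A a + 'i *: a = u n.
  by have [a Aa au] := Vu n; exists a.
(* By the isometry identity [symmetric_op_shift_sqr], a n and A (a n) converge
   with u n, so that closedness of A puts the limit in the range of A + i. *)
have aC m n : `|A (a m) - A (a n)| ^+ 2 + `|a m - a n| ^+ 2 = `|u m - u n| ^+ 2.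
  have [[Am um] [An un]] := (aP m, aP n).
  have [Amn <-] := linear_opB lA Am An.
  rewrite -symmetric_op_shift_sqr// (linear_opB lA Am An).2 -um -un.
  by rewrite scalerBr opprD addrACA.
have /cvg_ex[b ab] : cvg (a @ \oo).
  apply: (@cvg_of_sqr_natSinv _ _ 4) => m n mn.
  by rewrite (le_trans _ (uC _ _ mn))// -aC lerDr exprn_ge0.
have /cvg_ex[c Aac] : cvg ((fun n => A (a n)) @ \oo).
  apply: (@cvg_of_sqr_natSinv _ _ 4) => m n mn.
  by rewrite (le_trans _ (uC _ _ mn))// -aC lerDl exprn_ge0.
have [/= Ab cA] : dom A (b, c).1 /\ (b, c).2 = A (b, c).1.
  apply: (closed_cvg _ (@so_closed _ _ A) _ (b, c) (cvg_pair ab Aac)).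
  by apply: nearW => n /=; have [] := aP n.
have pE : p = A b + 'i *: b.
  apply: (cvg_unique (@norm_hausdorff _ _) up).
  have -> : u = (fun n => A (a n) + 'i *: a n).
    by apply/funext => n; have [_ ->] := aP n.
  by rewrite -cA; apply: cvgD => //; apply: cvgZr.
have qrel : adjoint_rel A (x - p) ('i *: (x - p)).
  move=> f Af; have := xp (A f + 'i *: f) (ex_intro2 _ _ f Af erefl).
  rewrite ipC => /eqP; rewrite conjC_eq0 linearDl/= ipZl addr_eq0 => /eqP ->.
  by rewrite ipZr conjCi mulNr.
exists b, (x - p); split=> //; last by rewrite -pE addrC subrK.
split; first by exists ('i *: (x - p)).
exact: adjoint_unique (so_dense A) qrel.
Qed.

Lemma adjoint_incl : op_incl A (adjoint A).
Proof.
have rel f : dom A f -> adjoint_rel A f (A f) by move=> Af g Ag; exact: so_sym.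
split=> f Af; first by exists (A f); exact: rel.
exact: adjoint_unique (so_dense A) (rel f Af).
Qed.

(** Write (A^* + i) f = (A + i) a + q with q in the kernel of A^* - i. There A^* + i acts as 2i, so
    it sends a + q / (2i) to the same vector as f, and the difference lies in the kernel of A^* +
    i. *)
Lemma von_neumann_decomposition f : dom (adjoint A) f -> exists a fp fm,
  [/\ dom A a, eigenspace_op (adjoint A) 'i fp,
      eigenspace_op (adjoint A) (- 'i) fm & f = a + fp + fm].
Proof.
move=> Asf; have lS := adjoint_linear (so_dense A).
have [a [q [Aa [Sq Aq] eq]]] :=
  symmetric_op_range_decomposition (adjoint A f + 'i *: f).
pose fp := (2 * 'i)^-1 *: q.
have [Sfp Afp] := linear_opZ (2 * 'i)^-1 lS Sq.
have [Sa Saa] : dom (adjoint A) a /\ adjoint A a = A a.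
  by split; [exact: adjoint_incl.1|exact: adjoint_incl.2].
have [S1 A1] := linear_opB lS Asf Sa.
have [S2 A2] := linear_opB lS S1 Sfp.
have i2 : 2 * 'i != 0 :> R[i] by rewrite mulf_neq0// neq0Ci.
exists a, fp, (f - a - fp); split=> //.
- by split; rewrite // /fp Afp Aq !scalerA mulrC.
- split => //; rewrite A2 A1 Saa.
  apply/eqP; rewrite -subr_eq0 scaleNr opprK !scalerBr.
  rewrite Afp Aq /fp !scalerA.
  have -> : adjoint A f - A a - ((2 * 'i)^-1 * 'i) *: q +
     ('i *: f - 'i *: a - ('i * (2 * 'i)^-1) *: q) =
     (adjoint A f + 'i *: f) - (A a + 'i *: a) -
       ((2 * 'i)^-1 * 'i + 'i * (2 * 'i)^-1) *: q.
    by rewrite scalerDl addrACA -opprD; congr (_ - _); rewrite opprD addrACA.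
  have -> : (2 * 'i)^-1 * 'i + 'i * (2 * 'i)^-1 = 1 :> R[i].
    by field; rewrite neq0Ci.
  by rewrite scale1r eq -[_ - _ - q]addrA -opprD subrr.
- by rewrite [RHS]addrC -[f - a - fp]addrA -opprD subrK.
Qed.

End VonNeumann.

Lemma has_dim1_line (R : realType) (H : hilbertType R) (V : set H) (g f : H) :
  has_dim V 1 -> V g -> g != 0 -> V f -> exists c : R[i], f = c *: g.
Proof.
move=> [e [_ ->]] [b _ <-] + [a _ <-].
rewrite !big_ord1 => be0; exists (a ord0 / b ord0).
have b0 : b ord0 != 0 by apply: contraNneq be0 => ->; rewrite scale0r.
by rewrite scalerA divfK.
Qed.

(** * Domain of the main operator and action of its adjoint on w *)

Section QuasiSelfadjoint.
Variables (R : realType) (H : hilbertType R).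
Variables (A : symmetric_operator H) (T : poperator H) (gp gm : H) (k : R[i]).
Hypothesis A11 : deficiency_indices A 1 1.
Hypothesis AT : quasi_selfadjoint_extension A T.
Hypothesis dissT : dissipative_op T.
Hypothesis gpP : eigenspace_op (adjoint A) 'i gp.
Hypothesis gmP : eigenspace_op (adjoint A) (- 'i) gm.
Hypotheses (gp1 : `|gp| = 1) (gm1 : `|gm| = 1) (k_real : k^* = k).

Local Notation y := (gp - k *: gm).
Local Notation w := (gm - k *: gp).
Hypothesis yT : dom T y.

Let ip_gp : ip gp gp = 1. Proof. by rewrite -ip_normE gp1 expr1n. Qed.
Let ip_gm : ip gm gm = 1. Proof. by rewrite -ip_normE gm1 expr1n. Qed.

Lemma qsa_densely_defined : densely_defined T.
Proof.
move=> U U0 oU; have [x [Ux Ax]] := so_dense A U0 oU.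
by exists x; split => //; case: AT => _ _ [/(_ x Ax)].
Qed.

(** Used for [y] with (c, d) = (1, k) and for [w] with (c, d) = (-k, -1). *)
Lemma adjoint_deficiency_comb c d :
  dom (adjoint A) (c *: gp - d *: gm) /\
  adjoint A (c *: gp - d *: gm) = 'i *: (c *: gp + d *: gm).
Proof.
have lS := adjoint_linear (so_dense A).
have [[Sp Ap] [Sm Am]] := (gpP, gmP).
have [Sp' Ap'] := linear_opZ c lS Sp.
have [Sm' Am'] := linear_opZ d lS Sm.
have [S' A'] := linear_opB lS Sp' Sm'.
split => //; rewrite A' Ap' Am' Ap Am scaleNr scalerN opprK scalerDr !scalerA.
by rewrite [c * _]mulrC [d * _]mulrC.
Qed.

Lemma main_operator_y : T y = 'i *: (gp + k *: gm).
Proof.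
case: AT => _ _ _ [_ /(_ y yT) <-].
by have [_] := adjoint_deficiency_comb 1 k; rewrite !scale1r.
Qed.

(** [gp] and [gm] need not be orthogonal in [H], so a cross term remains; multiplied by i it is
    real, hence invisible in the imaginary part. *)
Lemma ip_main_operator_y :
  ip (T y) y = 'i * (1 - k ^+ 2 + k * ((ip gp gm)^* - ip gp gm)).
Proof.
rewrite main_operator_y ipZl linearDl/= !linearBr/= !ipZl !ipZr k_real.
by rewrite ip_gp ip_gm (ipC gm gp); ring.
Qed.

(** Otherwise (T gm, gm) = -i, against dissipativity. *)
Lemma deficiency_gm_notin_dom : ~ dom T gm.
Proof.
move=> Tm; have := dissT Tm.
case: AT => _ _ _ [_ /(_ gm Tm) <-]; rewrite gmP.2 ipZl ip_gm mulr1.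
by rewrite -complexiE /= oppr_ge0 lt_geF.
Qed.

Lemma dom_qsa_extension f : dom T f ->
  exists a c, dom A a /\ f = a + c *: y.
Proof.
move=> Tf; case: AT => lT _ [AT1 _] [TA _].
have nz (g : H) : `|g| = 1 -> g != 0 by rewrite -normr_eq0 => ->; exact: oner_neq0.
have [a [fp [fm [Aa Sfp Sfm fE]]]] := von_neumann_decomposition (TA f Tf).
have [c cE] := has_dim1_line A11.1 gpP (nz _ gp1) Sfp.
have [d dE] := has_dim1_line A11.2 gmP (nz _ gm1) Sfm.
exists a, c; split=> //.
(* Substitute gp = y + k gm. *)
have fE' : f = a + c *: y + (d + c * k) *: gm.
  rewrite fE cE dE scalerBr scalerA scalerDl -!addrA; congr (_ + (_ + _)).
  by rewrite addrCA [X in _ + X]addrC subrr addr0.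
have [dk|dk] := eqVneq (d + c * k) 0; first by rewrite fE' dk scale0r addr0.
(* Otherwise a multiple of gm would be left over in the domain of T. *)
exfalso; apply: deficiency_gm_notin_dom.
have [Tcy _] := linear_opZ c lT yT.
have [T1 _] := linear_opB lT Tf (AT1 _ Aa).
have [T2 _] := linear_opB lT T1 Tcy.
have [+ _] := linear_opZ (d + c * k)^-1 lT T2.
have -> : f - a - c *: y = (d + c * k) *: gm.
  by rewrite fE' -[_ - a - _]addrA -opprD [X in X - _]addrC addrK.
by rewrite scalerA mulVf// scale1r.
Qed.

(** It suffices to test on a + c y. On a the identity is the one for A^*, whose domain contains w;
    on y it is a computation using that k is real and the basis vectors are unit. *)
Lemma adjoint_qsa_w :
  dom (adjoint T) w /\ adjoint T w = - 'i *: (gm + k *: gp).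
Proof.
suff rel : adjoint_rel T w (- 'i *: (gm + k *: gp)).
  split; first by exists (- 'i *: (gm + k *: gp)).
  exact: adjoint_unique qsa_densely_defined rel.
move=> f Tf; have [a [c [Aa ->]]] := dom_qsa_extension Tf.
case: (AT) => lT _ [AT1 AT2] _.
rewrite [a + _]addrC.
have [_ ->] : dom T (c *: y + a) /\ T (c *: y + a) = c *: T y + T a.
  by apply: lT.2 => //; exact: AT1.
rewrite (AT2 _ Aa) !ipDl; congr (c * _ + _).
  rewrite main_operator_y ipZl !linearDl/= !linearBr/= linearNl/= !ipZl.
  rewrite !ipZr !linearDr/= !ipZr k_real ip_gp ip_gm rmorphN/= conjCi; ring.
have [Sw Aw] := adjoint_deficiency_comb (- k) (-1).
have wE : - k *: gp - -1 *: gm = w.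
  by rewrite scaleNr scaleN1r opprK addrC.
rewrite wE in Sw Aw.
rewrite (adjoint_relP Sw)// Aw; congr (ip a _).
by rewrite scaleNr scaleN1r -opprD scalerN scaleNr [k *: _ + _]addrC.
Qed.

End QuasiSelfadjoint.

Lemma antidual0E (R : realType) (V : normedModType R[i]) (x : V) :
  (0 : antidual V) x = 0.
Proof. by rewrite -(scale0r (0 : antidual V)) antidualZE mul0r. Qed.

Lemma embedE (R : realType) (H : hilbertType R) (S : symmetric_operator H)
  (h : H) (x : Hplus S) : embed S h x = ip h (x : H).
Proof. by []. Qed.

(** * The state operator, its resolvent at -i and the transfer function *)

Section Transfer.
Variables (R : realType) (H : hilbertType R) (Theta : Lsystem H).

Let S := ls_sym Theta.
Let A : blinear (Hplus S) (Hminus S) := ls_state Theta.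
Let K : blinear R[i]^o (Hminus S) := ls_channel Theta.
Let Kadj := channel_adjoint K.

Lemma state_adjointE f x :
  A f x = dual_adjoint A f x + 2 * 'i * (Kadj f * (Kadj x)^*).
Proof.
have : dual_im A f x = K (Kadj f) x by rewrite ls_im.
rewrite channel_adjointE /dual_im blinearZE antidualZE blinearDE blinearNE.
rewrite antidualDE antidualNE => <-.
rewrite mulrA divff ?mul1r; first by rewrite addrC subrK.
by rewrite mulf_neq0// neq0Ci.
Qed.

Lemma state_im_pairing f : A f f - (A f f)^* = 2 * 'i * `|Kadj f| ^+ 2.
Proof. by rewrite {1}state_adjointE dual_adjointE normCK addrAC subrr add0r. Qed.

(** Pairing with f gives (A f, f) = -i (f, f), whose imaginary part is -(f, f) but also
    [|Kadj f| ^+ 2], so both vanish. *)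
Lemma state_shift_ker f : A f - - 'i *: embed S f = 0 -> f = 0.
Proof.
move=> Af0; have Aff : A f f = - 'i * ip (f : H) (f : H).
  have /eqP := congr1 (fun phi : Hminus S => phi f) Af0.
  by rewrite antidualDE antidualNE antidualZE subr_eq0 => /eqP.
have i2 : 2 * 'i != 0 :> R[i] by rewrite mulf_neq0// neq0Ci.
have ff : (ip (f : H) (f : H))^* = ip (f : H) (f : H) by rewrite -ipC.
have ffE : - ip (f : H) (f : H) = `|Kadj f| ^+ 2.
  apply: (mulfI i2); rewrite -state_im_pairing Aff rmorphM/= rmorphN/= conjCi ff.
  ring.
have ff0 : ip (f : H) (f : H) = 0.
  apply/eqP; rewrite eq_le dnorm_ge0 andbT -oppr_ge0 ffE.
  exact: exprn_ge0.
by apply: val_inj; apply/eqP; rewrite -[_ == 0](dnorm_eq0 ip) ff0.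
Qed.

Lemma state_shift_inj : injective (fun f => A f - - 'i *: embed S f).
Proof.
move=> f g /= /(congr1 (fun phi : Hminus S => phi _)) fg.
apply/eqP; rewrite -subr_eq0; apply/eqP; apply: state_shift_ker.
apply: antidual_ext => x; move: (fg x).
have -> : f - g = -1 *: g + f by rewrite scaleN1r addrC.
rewrite hplus_valP blinearP antidual0E !antidualDE !antidualNE !antidualZE /=.
rewrite ipDl => e.
by rewrite (canRL (subrK _) e); ring.
Qed.

(** Reduces the evaluation of the resolvent to exhibiting one solution. *)
Lemma bi_resolvent_unique f phi : A f - - 'i *: embed S f = phi ->
  bi_resolvent A (- 'i) phi = f.
Proof.
move=> Af; apply: xget_unique => // g Ag; apply: state_shift_inj.
by rewrite /= Af.
Qed.

Variables (gp gm : H) (k : R[i]).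
Hypothesis gpm : deficiency_basis Theta gp gm.
Hypothesis kP : von_neumann_parameter Theta gp gm k.
Hypothesis k_ge0 : 0 <= k.

Let k_real : k^* = k. Proof. exact: geC0_conj. Qed.

Let onemk_neq0 : 1 - k ^+ 2 != 0.
Proof.
by rewrite subr_eq0 eq_sym lt_eqF// expr_lt1//; case: kP; rewrite ger0_norm.
Qed.

Let conj_pairing a : ('i * (1 - k ^+ 2 + k * (a^* - a)))^* =
  - 'i * (1 - k ^+ 2 + k * (a - a^*)).
Proof.
rewrite rmorphM/= conjCi; congr (_ * _).
rewrite rmorphD/= rmorphM/= !rmorphB/= rmorph1 rmorphXn/= conjCK k_real.
by [].
Qed.

(** The value assumed is shared by the lifts of y and w to the positive space; subtracting its
    conjugate removes the cross term. *)
Lemma norm_sqr_channel_adjoint f :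
  A f f = 'i * (1 - k ^+ 2 + k * ((ip gp gm)^* - ip gp gm)) ->
  `|Kadj f| ^+ 2 = 1 - k ^+ 2.
Proof.
move=> Aff; have i2 : 2 * 'i != 0 :> R[i] by rewrite mulf_neq0// neq0Ci.
apply: (mulfI i2); rewrite -state_im_pairing Aff.
by rewrite conj_pairing; ring.
Qed.

Lemma norm_transfer_function : `|transfer_function Theta (- 'i)| = k.
Proof.
have [gpP gmP gp1 gm1] := gpm; have [_ yT] := kP.
have S11 := ls_deficiency Theta; have qT := ls_quasi_selfadjoint Theta.
have dT := @ls_dissipative _ _ Theta.
have [AT _ AsT _ _] := ls_star Theta.
have [Y Yy AY] := AT _ yT.
have [wT Tw] := adjoint_qsa_w S11 qT dT gpP gmP gp1 gm1 k_real yT.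
have [W Ww AW] := AsT _ wT.
have Ty := main_operator_y qT gpP gmP yT.
have KY : `|Kadj Y| ^+ 2 = 1 - k ^+ 2.
  apply: norm_sqr_channel_adjoint; rewrite AY /= Yy.
  exact: (ip_main_operator_y qT).
have KW : `|Kadj W| ^+ 2 = 1 - k ^+ 2.
  apply: norm_sqr_channel_adjoint.
  (* Only the adjoint of [A] is known on [W], so (A W, W) is computed as the conjugate of (A^* W,
     W). *)
  rewrite -[A W W]conjCK -dual_adjointE AW Tw /= Ww -[RHS]conjCK conj_pairing.
  congr (_^*); rewrite ipZl linearDl/= !linearBr/= !ipZl !ipZr k_real.
  by rewrite -!ip_normE gp1 gm1 expr1n (ipC gm gp); ring.
have KW0 : Kadj W != 0.
  by apply: contraNneq onemk_neq0 => KW0; rewrite -KW KW0 normr0 expr0n.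
(* Normalizes the image of k Y + W under A + i, which is 2i (K^* W) K 1. *)
pose c := (2 * 'i * Kadj W)^-1.
have cE : 2 * 'i * Kadj W * c = 1.
  by rewrite mulfV// !mulf_neq0// neq0Ci.
(* The summand 0 gives f the shape expected by blinearP and hplus_valP. *)
pose f := c *: (k *: Y + W) + 0.
have fE : A f - - 'i *: embed S f = K 1.
  have val0 : hplus_val (0 : Hplus S) = 0 by exact: (raddf0 (\val : Hplus S -> H)).
  apply: antidual_ext => x; rewrite channel_adjointE mul1r -/Kadj.
  rewrite /f !hplus_valP !blinearP linear0 val0 Yy Ww !addr0.
  rewrite antidualDE antidualNE !antidualZE antidualDE antidualZE.
  (* Trading A W for A^* W costs a multiple of K 1; the rest vanishes since k T y + T^* w + i (k y +
     w) = 0. *)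
  rewrite AY Ty [A W x]state_adjointE AW Tw !embedE.
  transitivity (2 * 'i * Kadj W * c * (Kadj x)^*); last by rewrite cE mul1r.
  by rewrite !(ipZl, ip_subl, ip_addl); ring.
have Kf : 2 * 'i * Kadj f = 1 + k * (Kadj Y / Kadj W).
  rewrite /f !blinearP linear0 addr0.
  have -> : c *: (k *: Kadj Y + Kadj W) = c * (k * Kadj Y + Kadj W) by [].
  by rewrite /c; field; rewrite KW0 neq0Ci.
rewrite /transfer_function -/A -/K -/Kadj (bi_resolvent_unique fE) Kf.
rewrite opprD addrA subrr sub0r normrN !normrM normfV ger0_norm//.
have -> : `|Kadj Y| = `|Kadj W|.
  by apply/eqP; rewrite -(@eqrXn2 _ 2)// ?KY ?KW.
by rewrite divff ?mulr1// normr_eq0.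
Qed.

End Transfer.

Theorem lemma11 (R : realType) (H : hilbertType R) (Theta : Lsystem H)
    (gp gm : H) (kappa : R[i]) :
  deficiency_basis Theta gp gm ->
  von_neumann_parameter Theta gp gm kappa ->
  0 <= kappa <= 1 ->
  ((dissipation_coefficient Theta gp gm kappa)%:E
     = 1 - expeR (- (2%:E * c_entropy Theta)))%E.
Proof.
move=> gpm kP /andP[k0 _].
have [gpP gmP gp1 gm1] := gpm; have [_ yT] := kP.
have kE : kappa = (complex.Re kappa)%:C%C by rewrite RRe_real// ger0_real.
have -> : dissipation_coefficient Theta gp gm kappa = 1 - complex.Re kappa ^+ 2.
  rewrite /dissipation_coefficient.
  rewrite (ip_main_operator_y (ls_quasi_selfadjoint Theta))//; last exact: geC0_conj.
  rewrite -complexiE kE; case: (ip gp gm) => a b /=.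
  rewrite !(mul0r, mulr0, mul1r, addr0, add0r, subr0, oppr0, expr2)/=.
  ring.
rewrite /c_entropy (norm_transfer_function gpm kP k0) EFinB; congr (_ - _)%E.
have : 0 <= complex.Re kappa by rewrite -lecR -kE.
(* For [kappa] equal to 0 the entropy is infinite and the exponential is 0; otherwise it is exp (2
   ln kappa). *)
rewrite le_eqVlt => /predU1P[<-|r0].
  by rewrite le0_lneNy//= expr0n gt0_muley//= lte_fin.
rewrite lne_EFin//= mulrN opprK.
by rewrite expRM_natl lnK.
Qed.
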